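(* (Green's function, two-point boundary value problem) Let $T>0$, $I=[-T,T]$, let $A,B,C,F,G,K$ be real $n\times n$ matrices with $F-G$ and $F+G$ invertible, $\gamma:I\to\mathbb R^n$ continuous and $\delta\in\mathbb R^n$. Let $X$ and $Y$ be fundamental matrices of the homogeneous systems $$Fu'(t)+Gu'(-t)+Au(t)+Bu(-t)=0\quad\text{and}\quad Fu'(t)-Gu'(-t)+Au(t)-Bu(-t)=0,$$ respectively. Suppose that $\mathcal X(t)=\left(\begin{array}{c|c}X_e(t)&Y_o(t)\\\hline X_o(t)&Y_e(t)\end{array}\right)$ is invertible for every $t\in I$ and that $M_X:=CX(-T)+KX(T)$ is invertible. Then the problem $$Fu'(t)+Gu'(-t)+Au(t)+Bu(-t)=\gamma(t),\ t\in I,\qquad Cu(-T)+Ku(T)=\delta,$$ has a unique solution $u$, and it is given by $$u(t)=X(t)M_X^{-1}\delta+\int_{-T}^T\mathcal G(t,s)\gamma(s)\,ds,$$ where, with $$Z(t)=\bigl(X(t)\,|\,Y(t)\bigr),\quad V_\pm=\begin{pmatrix}\pm(F-G)^{-1}\\(F+G)^{-1}\end{pmatrix},\quad \Gamma_C(t)=X(t)M_X^{-1}C\,Z(-T),\quad \Gamma_K(t)=X(t)M_X^{-1}K\,Z(T),$$ $$\mathcal G(t,s)=\frac12\begin{cases} [-\Gamma_K(t)+Z(t)]\,\mathcal X(s)^{-1}V_++\Gamma_C(t)\,\mathcal X(-s)^{-1}V_-,&0<s<t,\\ \Gamma_C(t)\,\mathcal X(s)^{-1}V_++[-\Gamma_K(t)+Z(t)]\,\mathcal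 X(-s)^{-1}V_-,&0<-s<t,\\ -\Gamma_K(t)\,\mathcal X(s)^{-1}V_++[\Gamma_C(t)-Z(t)]\,\mathcal X(-s)^{-1}V_-,&0<s<-t,\\ [\Gamma_C(t)-Z(t)]\,\mathcal X(s)^{-1}V_+-\Gamma_K(t)\,\mathcal X(-s)^{-1}V_-,&0<-s<-t,\\ -\Gamma_K(t)\,\mathcal X(s)^{-1}V_++\Gamma_C(t)\,\mathcal X(-s)^{-1}V_-,&|t|<s,\\ \Gamma_C(t)\,\mathcal X(s)^{-1}V_+-\Gamma_K(t)\,\mathcal X(-s)^{-1}V_-,&|t|<-s. \end{cases}$$
   Context: For a function $f$, $f_e(t)=\tfrac12(f(t)+f(-t))$ and $f_o(t)=\tfrac12(f(t)-f(-t))$ are its even and odd parts. $(X(t)\,|\,Y(t))$ is the $n\times 2n$ block matrix. $u'(-t)$ is the derivative of $u$ evaluated at $-t$. A fundamental matrix of $F u'(t)+G u'(-t)+Au(t)+Bu(-t)=0$, $t\in\mathbb R$, is a continuous $X:\mathbb R\to M_n(\mathbb R)$ that is differentiable, satisfies $FX'(t)+GX'(-t)+AX(t)+BX(-t)=0$ for all $t\in\mathbb R$, has $X(0)$ invertible, and whose columns form a basis of the space of solutions of the system; for the second system replace $G,B$ by $-G,-B$. For each $t$, $\mathcal G(t,\cdot)$ is left undefined on a set of measure zero, which is irrelevant for the integral. *)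

(* Defs.v *)
From HB Require Import structures.
From mathcomp Require Import all_boot all_order all_algebra.
From mathcomp Require Import all_classical all_reals all_analysis.

Set Implicit Arguments.
Unset Strict Implicit.
Unset Printing Implicit Defensive.

Import Order.TTheory GRing.Theory Num.Theory.
Import numFieldNormedType.Exports.

Local Open Scope classical_set_scope.
Local Open Scope ring_scope.

Section Defs.
Context {R : realType} {n : nat}.

Definition even_part {V : lmodType R} (f : R -> V) (t : R) : V :=
  2^-1 *: (f t + f (- t)).

Definition odd_part {V : lmodType R} (f : R -> V) (t : R) : V :=
  2^-1 *: (f t - f (- t)).

(* Derivative at t of a function of which only the restriction to I matters
   (one-sided at the endpoints when I is a closed interval); compare
   [derivable] and [derive1], which use the full punctured neighborhood. *)
Definition derivable_on {V : normedModType R} (I : set R) (u : R -> V) (t : R)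
    : Prop :=
  cvg (h^-1 *: (u (h + t) - u t) @[h --> within [set h | I (h + t)] 0^']).

Definition derive_on {V : normedModType R} (I : set R) (u : R -> V) (t : R)
    : V :=
  lim (h^-1 *: (u (h + t) - u t) @[h --> within [set h | I (h + t)] 0^']).

(* Applied with m = 1 to vector-valued and with m = n to matrix-valued
   functions. *)
Definition homogeneous_solution {m : nat} (F G A B : 'M[R]_n)
    (u : R -> 'M[R]_(n, m)) : Prop :=
  (forall t : R, derivable u t 1) /\
  (forall t, F *m u^`()%classic t + G *m u^`()%classic (- t) + A *m u t + B *m u (- t) = 0).

Definition is_finite_basis {V : lmodType R} (S : set V) (b : 'I_n -> V)
    : Prop :=
  [/\ forall j, S (b j),
      forall c : 'I_n -> R, \sum_j c j *: b j = 0 -> forall j, c j = 0 &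
      forall v, S v -> exists c : 'I_n -> R, v = \sum_j c j *: b j].

Definition fundamental_matrix (F G A B : 'M[R]_n) (X : R -> 'M[R]_n) : Prop :=
  [/\ continuous X,
      homogeneous_solution F G A B X,
      X 0 \in unitmx &
      is_finite_basis
        [set u : R -> 'cV[R]_n | homogeneous_solution F G A B u]
        (fun j t => col j (X t))].

Definition bvp_solution (T : R) (F G A B C K : 'M[R]_n)
    (gamma : R -> 'cV[R]_n) (delta : 'cV[R]_n) (u : R -> 'cV[R]_n) : Prop :=
  [/\ forall t : R, t \in `[- T, T] -> derivable_on `[- T, T] u t,
      forall t : R, t \in `[- T, T] ->
        F *m derive_on `[- T, T] u t + G *m derive_on `[- T, T] u (- t)
          + A *m u t + B *m u (- t) = gamma t &
      C *m u (- T) + K *m u T = delta].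

Definition calX (X Y : R -> 'M[R]_n) (t : R) : 'M[R]_(n + n) :=
  block_mx (even_part X t) (odd_part Y t) (odd_part X t) (even_part Y t).

Definition Zmx (X Y : R -> 'M[R]_n) (t : R) : 'M[R]_(n, n + n) :=
  row_mx (X t) (Y t).

Definition Vplus (F G : 'M[R]_n) : 'M[R]_(n + n, n) :=
  col_mx (invmx (F - G)) (invmx (F + G)).

Definition Vminus (F G : 'M[R]_n) : 'M[R]_(n + n, n) :=
  col_mx (- invmx (F - G)) (invmx (F + G)).

Definition MX (T : R) (C K : 'M[R]_n) (X : R -> 'M[R]_n) : 'M[R]_n :=
  C *m X (- T) + K *m X T.

Definition GammaC (T : R) (C K : 'M[R]_n) (X Y : R -> 'M[R]_n) (t : R) :=
  X t *m invmx (MX T C K X) *m C *m Zmx X Y (- T).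

Definition GammaK (T : R) (C K : 'M[R]_n) (X Y : R -> 'M[R]_n) (t : R) :=
  X t *m invmx (MX T C K X) *m K *m Zmx X Y T.

(* For fixed t, the six cases miss only the s in {0, t, -t}; the value there
   is set to 0. *)
Definition green (T : R) (F G C K : 'M[R]_n) (X Y : R -> 'M[R]_n) (t s : R)
    : 'M[R]_n :=
  let GC := GammaC T C K X Y t in
  let GK := GammaK T C K X Y t in
  let Z := Zmx X Y t in
  let P := invmx (calX X Y s) *m Vplus F G in
  let Q := invmx (calX X Y (- s)) *m Vminus F G in
  2^-1 *:
  (if 0 < s < t then (- GK + Z) *m P + GC *m Q
   else if 0 < - s < t then GC *m P + (- GK + Z) *m Q
   else if 0 < s < - t then - GK *m P + (GC - Z) *m Q
   else if 0 < - s < - t then (GC - Z) *m P - GK *m Q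
   else if `|t| < s then - GK *m P + GC *m Q
   else if `|t| < - s then GC *m P - GK *m Q
   else 0).

Definition integrable_vec (D : set R) (f : R -> 'cV[R]_n) : Prop :=
  forall i, (@lebesgue_measure R).-integrable D (fun s => (f s i 0)%:E).

Definition integral_vec (D : set R) (f : R -> 'cV[R]_n) : 'cV[R]_n :=
  \col_i \int[@lebesgue_measure R]_(s in D) f s i 0.

End Defs.

(* Main.v *)
Require Import Defs.
From HB Require Import structures.
From mathcomp Require Import all_boot all_order all_algebra.
From mathcomp Require Import all_classical all_reals all_analysis.
From mathcomp Require Import measurable_realfun ring lra.

Set Implicit Arguments.
Unset Strict Implicit.
Unset Printing Implicit Defensive.

Import Order.TTheory GRing.Theory Num.Theory.
Import numFieldNormedType.Exports.

Local Open Scope classical_set_scope.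
Local Open Scope ring_scope.

(** With [u_e], [u_o] the even and odd parts of [u], the equation
    [F u'(t) + G u'(-t) + A u(t) + B u(-t) = gamma(t)] is the ordinary linear
    system
      [(F - G) u_e' + (A - B) u_o = gamma_o],
      [(F + G) u_o' + (A + B) u_e = gamma_e],
    for which [calX] is a fundamental matrix. Variation of parameters gives
    [u = X c + Z w] with
    [w(t) = int_0^t calX(s)^-1 (V_+ gamma(s) + V_- gamma(-s)) / 2 ds]; the
    boundary condition fixes [c] since [M_X] is invertible. For
    [J = diag(1, -1)] one has [calX(-s) = J calX(s) J] and [V_- = - J V_+], so
    with [p(s) = calX(s)^-1 V_+ gamma(s)] and [P(t) = int_0^t p],
    [w(t) = (P(t) + J P(-t)) / 2]: no change of variables is needed. *)

(** * Entrywise differentiation and continuity of matrix functions *)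

Section MatrixCalculus.
Context {R : realType}.

(* Unlike [mxE], does not expand products into sums, so that [ring] sees them as
   atoms. *)
Lemma mx_linE {m n} :
  (forall (M N : 'M[R]_(m, n)) i j, (M + N) i j = M i j + N i j) *
  (forall (M : 'M[R]_(m, n)) i j, (- M) i j = - M i j) *
  (forall (a : R) (M : 'M[R]_(m, n)) i j, (a *: M) i j = a * M i j) *
  (forall i j, (0 : 'M[R]_(m, n)) i j = 0).
Proof. by repeat split=> *; rewrite mxE. Qed.

Lemma is_derive_mxP {m n} (M : R -> 'M[R]_(m, n)) (t : R) (D : 'M[R]_(m, n)) :
  is_derive t 1 M D <-> forall i j, is_derive t 1 (fun s => M s i j) (D i j).
Proof.
split=> [[dM <-] i j|dM].
  rewrite derive_mx// mxE; apply: derivableP.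
  by move/derivable_mxP : dM; exact.
have dM' : derivable M t 1 by apply/derivable_mxP => i j; exact: ex_derive.
split=> //; rewrite derive_mx//; apply/matrixP => i j; rewrite mxE.
exact: derive_val.
Qed.

Lemma is_derive_mulmx {m n p} (M : R -> 'M[R]_(m, n)) (N : R -> 'M[R]_(n, p))
    (t : R) M' N' :
  is_derive t 1 M M' -> is_derive t 1 N N' ->
  is_derive t 1 (fun s => M s *m N s) (M' *m N t + M t *m N').
Proof.
move=> /is_derive_mxP dM /is_derive_mxP dN; apply/is_derive_mxP => i j.
have -> : (fun s => (M s *m N s) i j) =
    \sum_k ((fun s => M s i k) * (fun s => N s k j) : R -> R).
  by apply/funext => s; rewrite mxE fct_sumE.
apply: is_derive_eq; rewrite !mxE -big_split/=; apply: eq_bigr => k _.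
by rewrite addrC [M' i k * _]mulrC.
Qed.

Lemma is_derive_mulmxl {m n p} (M : 'M[R]_(m, n)) (N : R -> 'M[R]_(n, p))
    (t : R) N' :
  is_derive t 1 N N' -> is_derive t 1 (fun s => M *m N s) (M *m N').
Proof.
move=> dN; apply: is_derive_eq; first exact: (is_derive_mulmx (is_derive_cst M t 1) dN).
by rewrite mul0mx add0r.
Qed.

Lemma is_derive_mulmxr {m n p} (M : R -> 'M[R]_(m, n)) (N : 'M[R]_(n, p))
    (t : R) M' :
  is_derive t 1 M M' -> is_derive t 1 (fun s => M s *m N) (M' *m N).
Proof.
move=> dM; apply: is_derive_eq; first exact: (is_derive_mulmx dM (is_derive_cst N t 1)).
by rewrite mulmx0 addr0.
Qed.

Lemma is_derive_mx_oppr {m n} (M : R -> 'M[R]_(m, n)) (t : R) M' :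
  is_derive (- t) 1 M M' -> is_derive t 1 (fun s => M (- s)) (- M').
Proof.
move=> /is_derive_mxP dM; apply/is_derive_mxP => i j.
rewrite mxE -mulrN1.
exact: (is_derive1_comp (dM i j) (is_deriveNid t 1)).
Qed.

Lemma is_derive_row_mx {m n1 n2} (M : R -> 'M[R]_(m, n1))
    (N : R -> 'M[R]_(m, n2)) (t : R) M' N' :
  is_derive t 1 M M' -> is_derive t 1 N N' ->
  is_derive t 1 (fun s => row_mx (M s) (N s)) (row_mx M' N').
Proof.
move=> /is_derive_mxP dM /is_derive_mxP dN; apply/is_derive_mxP => i j.
rewrite -[j]splitK; case: (fintype.split j) => k /=.
  by rewrite row_mxEl; under eq_fun do rewrite row_mxEl.
by rewrite row_mxEr; under eq_fun do rewrite row_mxEr.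
Qed.

Lemma is_derive_col_mx {m1 m2 n} (M : R -> 'M[R]_(m1, n))
    (N : R -> 'M[R]_(m2, n)) (t : R) M' N' :
  is_derive t 1 M M' -> is_derive t 1 N N' ->
  is_derive t 1 (fun s => col_mx (M s) (N s)) (col_mx M' N').
Proof.
move=> /is_derive_mxP dM /is_derive_mxP dN; apply/is_derive_mxP => i j.
rewrite -[i]splitK; case: (fintype.split i) => k /=.
  by rewrite col_mxEu; under eq_fun do rewrite col_mxEu.
by rewrite col_mxEd; under eq_fun do rewrite col_mxEd.
Qed.

Lemma is_derive_even_part {m n} (M : R -> 'M[R]_(m, n)) (t : R) a b :
  is_derive t 1 M a -> is_derive (- t) 1 M b ->
  is_derive t 1 (even_part M) (2^-1 *: (a - b)).
Proof.
move=> da db; apply: is_deriveZ; apply: is_deriveD => //.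
exact: is_derive_mx_oppr.
Qed.

Lemma is_derive_odd_part {m n} (M : R -> 'M[R]_(m, n)) (t : R) a b :
  is_derive t 1 M a -> is_derive (- t) 1 M b ->
  is_derive t 1 (odd_part M) (2^-1 *: (a + b)).
Proof.
move=> da db; apply: is_deriveZ; rewrite -[b]opprK; apply: is_deriveB => //.
exact: is_derive_mx_oppr.
Qed.

Lemma continuous_mxP {m n} {U : topologicalType} (M : U -> 'M[R]_(m, n)) t :
  {for t, continuous M} <->
  forall i j, {for t, continuous (fun s => M s i j)}.
Proof.
split=> [cM i j|cM].
  apply: (@continuous_comp _ _ _ M (fun N : 'M[R]_(m, n) => N i j)) => //.
  exact: coord_continuous.
apply/cvgrPdist_le => /= e e0; near=> s.
rewrite /Num.Def.normr/= mx_normrE (bigmax_le _ (ltW e0))//= => i _.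
rewrite !mxE/=; move: i; near: s; apply: filter_forall => /= i.
exact: ((cvgrPdist_le _ _).1 (cM i.1 i.2)).
Unshelve. all: by end_near. Qed.

Lemma continuous_mulmx {m n p} {U : topologicalType} (M : U -> 'M[R]_(m, n))
    (N : U -> 'M[R]_(n, p)) t :
  {for t, continuous M} -> {for t, continuous N} ->
  {for t, continuous (fun s => M s *m N s)}.
Proof.
move=> /continuous_mxP cM /continuous_mxP cN; apply/continuous_mxP => i j.
rewrite (_ : (fun s => _) = fun s => \sum_k M s i k * N s k j); last first.
  by apply/funext => s; rewrite mxE.
by apply: cvg_big; [exact: add_continuous|move=> k _; apply: cvgM; [exact: cM|exact: cN]].
Qed.

Lemma continuous_col_mx {m1 m2 n} {U : topologicalType} (M : U -> 'M[R]_(m1, n))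
    (N : U -> 'M[R]_(m2, n)) t :
  {for t, continuous M} -> {for t, continuous N} ->
  {for t, continuous (fun s => col_mx (M s) (N s))}.
Proof.
move=> /continuous_mxP cM /continuous_mxP cN; apply/continuous_mxP => i j.
rewrite -[i]splitK; case: (fintype.split i) => k /=.
  rewrite (_ : (fun s => _) = fun s => M s k j); first exact: cM.
  by apply/funext => s; rewrite col_mxEu.
rewrite (_ : (fun s => _) = fun s => N s k j); first exact: cN.
by apply/funext => s; rewrite col_mxEd.
Qed.

Lemma continuous_det {n} {U : topologicalType} (M : U -> 'M[R]_n) t :
  {for t, continuous M} -> {for t, continuous (fun s => \det (M s))}.
Proof.
move=> /continuous_mxP cM; apply: cvg_big; first exact: add_continuous.
move=> s _; apply: cvgM; first exact: cvg_cst.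
by apply: cvg_big; [exact: mul_continuous|move=> i _; exact: cM].
Qed.

(** Cramer's rule writes the inverse as adjugate over determinant, both polynomial in the entries.
    Invertibility is asked at every point so that this formula for [invmx] is an equality of
    functions. *)
Lemma continuous_invmx {n} {U : topologicalType} (M : U -> 'M[R]_n) t :
  (forall s, M s \in unitmx) ->
  {for t, continuous M} -> {for t, continuous (fun s => invmx (M s))}.
Proof.
move=> uM cM.
have cadj : {for t, continuous (fun s => \adj (M s))}.
  apply/continuous_mxP => i j.
  rewrite (_ : (fun s => _) =
    fun s => (-1) ^+ (j + i) * \det (row' j (col' i (M s)))); last first.
    by apply/funext => s; rewrite mxE.
  apply: cvgM; first exact: cvg_cst.
  apply: (@continuous_det _ _ (fun s => row' j (col' i (M s)))).
  apply/continuous_mxP => k l.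
  rewrite (_ : (fun s => _) = fun s => M s (lift j k) (lift i l)).
    exact: (continuous_mxP M t).1.
  by apply/funext => s; rewrite !mxE.
rewrite (_ : (fun s => _) = fun s => (\det (M s))^-1 *: \adj (M s)).
  apply: cvgZ => //; apply: cvgV; last exact: continuous_det.
  by move: (uM t); rewrite unitmxE unitfE.
by apply/funext => s; rewrite /invmx uM.
Qed.

End MatrixCalculus.

(** * Derivatives relative to an interval, and extension from the interval to the line *)

Section DerivativeOnInterval.
Context {R : realType}.
Implicit Types (T t : R) (I : set R).

Lemma diff_quotientE {V : normedModType R} (u : R -> V) t :
  (fun h : R => h^-1 *: ((u \o shift t) (h *: 1) - u t)) =
  (fun h : R => h^-1 *: (u (h + t) - u t)).
Proof. by apply/funext => h /=; rewrite [h *: 1]mulr1. Qed.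

(** Properness makes limits along this filter unique, hence gives [derive_on] its meaning at the
    endpoints too. A step of length at most [T] to the right from [t <= 0], or to the left from
    [t > 0], stays in the interval. *)
Lemma within_dnbhs_itv_proper T t : 0 < T -> t \in `[- T, T] ->
  ProperFilter (within [set h | `[- T, T]%classic (h + t)] 0^').
Proof.
move=> T0; rewrite in_itv/= => /andP[Tt tT].
apply: Build_ProperFilter_ex => B; rewrite /within/= => -[/= e e0 eB].
pose h := Num.min (e / 2) T.
have h0 : 0 < h by rewrite lt_min T0 divr_gt0.
have he : h < e by rewrite gt_min; apply/orP; left; lra.
have hT : h <= T by rewrite ge_min lexx orbT.
have [t0|t0] := leP t 0.
  exists h; apply: eB => /=.
  - by rewrite sub0r normrN gtr0_norm.
  - by rewrite gt_eqF.
  - by rewrite in_itv/=; apply/andP; split; lra.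
exists (- h); apply: eB => /=.
- by rewrite sub0r opprK gtr0_norm.
- by rewrite oppr_eq0 gt_eqF.
- by rewrite in_itv/=; apply/andP; split; lra.
Qed.

Lemma is_derive_derive_on {V : normedModType R} (u : R -> V) T t D :
  0 < T -> t \in `[- T, T] -> is_derive t 1 u D ->
  derivable_on `[- T, T] u t /\ derive_on `[- T, T] u t = D.
Proof.
move=> T0 tT [du uD].
have FF := within_dnbhs_itv_proper T0 tT.
have cu : h^-1 *: (u (h + t) - u t)
    @[h --> within [set h | `[- T, T]%classic (h + t)] 0^'] --> D.
  rewrite -uD /derive diff_quotientE; move: du; rewrite /derivable diff_quotientE => du.
  by apply: cvg_trans du; apply: cvg_app; exact: cvg_within.
split; first by apply/cvg_ex; exists D.
exact: (cvg_lim (@norm_hausdorff _ V)).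
Qed.

(** At an interior point every small increment stays in the interval, so the restricted filter is
    the full punctured neighborhood filter. *)
Lemma derivable_on_is_derive {V : normedModType R} (u : R -> V) T t :
  t \in `]- T, T[ -> derivable_on `[- T, T] u t ->
  is_derive t 1 u (derive_on `[- T, T] u t).
Proof.
rewrite in_itv/= => /andP[Tt tT].
rewrite /derivable_on /derive_on.
have -> : within [set h | `[- T, T]%classic (h + t)] 0^' = 0^'.
  rewrite predeqE => B; split; last exact: cvg_within.
  rewrite /within/= => BI.
  have : \forall h \near 0^', `[- T, T]%classic (h + t).
    near=> h.
    have : `|h| < Num.min (t + T) (T - t).
      by near: h; apply: dnbhs0_lt; rewrite lt_min; apply/andP; split; lra.
    rewrite lt_min !ltr_norml /= in_itv/= => /andP[/andP[? ?] /andP[? ?]].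
    by apply/andP; split; lra.
  by apply: filterS2 BI => h hB; exact: hB.
by move=> du; apply: DeriveDef; rewrite /derivable /derive diff_quotientE.
Unshelve. all: by end_near. Qed.

(** Near [t] the difference quotient lies within 1 of its limit [l], so [u] satisfies a Lipschitz
    bound at [t] with constant [|l| + 1]. *)
Lemma derivable_on_continuous {V : normedModType R} (u : R -> V) I t :
  derivable_on I u t -> u @ within I (nbhs t) --> u t.
Proof.
move=> /cvg_ex[/= l ul].
apply/cvgrPdist_lt => e e0; rewrite near_withinE.
have /cvgrPdist_lt /(_ 1 ltr01) := ul.
rewrite near_withinE near_withinE => ul1.
have Pd : 0 < e / (`|l| + 1) by rewrite divr_gt0// ltr_wpDl.
have {}ul1 : \forall h \near (0 : R), h != 0 -> I (h + t) ->
    `|l - h^-1 *: (u (h + t) - u t)| < 1 by [].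
have : \forall s \near t, (s - t) != 0 -> I (s - t + t) ->
    `|l - (s - t)^-1 *: (u (s - t + t) - u t)| < 1.
  have c : (fun s => s - t) @ t --> (0 : R).
    by rewrite -(subrr t); apply: cvgB; [exact: cvg_id|exact: cvg_cst].
  exact: c ul1.
have : \forall s \near t, `|t - s| < e / (`|l| + 1).
  by apply/nbhs_ballP; exists (e / (`|l| + 1)).
apply: filterS2 => s st; rewrite subrK subr_eq0 => Hs sI.
have [->|st'] := eqVneq s t; first by rewrite subrr normr0.
have {}Hs := Hs st' sI.
have nst : s - t != 0 by rewrite subr_eq0.
have ut : u s - u t = (s - t) *: ((s - t)^-1 *: (u s - u t)).
  by rewrite scalerA mulfV// scale1r.
rewrite distrC ut normrZ.
have Hl : `|(s - t)^-1 *: (u s - u t)| <= `|l| + 1.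
  rewrite -[X in `|X|](subKr l) (le_trans (ler_normB _ _))// lerD2l.
  exact: ltW.
apply: le_lt_trans (ler_wpM2l (normr_ge0 _) Hl) _.
by rewrite -ltr_pdivlMr ?ltr_wpDl// distrC.
Qed.

(** The retraction of the line onto [[-T, T]]. Precomposing with it turns a function that is
    controlled only on the interval into one continuous on the whole line, without changing it on
    the interval. *)
Definition clamp T t : R := Num.max (- T) (Num.min t T).

Lemma clamp_itv T t : 0 < T -> clamp T t \in `[- T, T].
Proof.
move=> T0; rewrite in_itv/= /clamp le_max lexx/= ge_max ge_min lexx orbT andbT.
by lra.
Qed.

Lemma clamp_id T t : t \in `[- T, T] -> clamp T t = t.
Proof.
by rewrite in_itv/= /clamp => /andP[Tt tT]; rewrite min_l// max_r.
Qed.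

Lemma continuous_clamp T : continuous (clamp T).
Proof.
move=> t; apply/cvgrPdist_lt => e e0.
have : \forall s \near t, `|t - s| < e by apply/nbhs_ballP; exists e.
apply: filterS => s; apply: le_lt_trans; rewrite /clamp.
(* The retraction is 1-Lipschitz; this is checked in each position of [s] and [t]. *)
by rewrite /Num.max /Num.min; (do ! case: ifPn); rewrite -?leNgt => *;
  rewrite ler_norml; have := ler_norm (t - s); have := ler_norm (s - t);
  rewrite (distrC s) => *; apply/andP; split; lra.
Qed.

Lemma continuous_comp_clamp {V : topologicalType} (u : R -> V) T : 0 < T ->
  (forall t, t \in `[- T, T] -> u @ within `[- T, T] (nbhs t) --> u t) ->
  continuous (u \o clamp T).
Proof.
move=> T0 cu t.
apply: (@cvg_comp _ _ _ (clamp T) u _ _ _ _ (cu _ (clamp_itv t T0))) => B /= BI.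
have : \forall s \near t, `[- T, T]%classic (clamp T s) -> B (clamp T s).
  exact: continuous_clamp BI.
by apply: filterS => s; apply;
exact: (clamp_itv s T0).
Qed.

Lemma near_clamp T t : t \in `]- T, T[ -> \forall s \near t, clamp T s = s.
Proof.
move=> tT; have : \forall s \near t, s \in `]- T, T[ by exact: near_in_itvoo.
apply: filterS => s; rewrite in_itv/= => /andP[? ?].
by apply: clamp_id; rewrite in_itv/= !ltW.
Qed.

(** The mean value theorem needs the derivative only in the open interval; continuity carries the
    conclusion to the endpoints. *)
Lemma cst_of_is_derive0 (f : R -> R) T s t : continuous f ->
  (forall r, r \in `]- T, T[ -> is_derive r 1 f 0) ->
  s \in `[- T, T] -> t \in `[- T, T] -> f s = f t.
Proof.
move=> cf df; wlog st : s t / s <= t => [H sT tT|].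
  by case: (leP s t) => [/H|/ltW /H ->//]; exact.
rewrite !in_itv/= => /andP[Ts sT] /andP[Tt tT].
have cfst : {within `[s, t], continuous f} by exact: continuous_subspaceT.
have dfst r : r \in `]s, t[%R -> is_derive r 1 f (cst 0 r).
  rewrite in_itv/= => /andP[? ?]; apply: df; rewrite in_itv/=.
  by apply/andP; split; lra.
have [r _] := MVT_segment st dfst cfst.
by rewrite mul0r => /eqP; rewrite subr_eq0 => /eqP.
Qed.

(* The continuity of a factor suffices because the other one vanishes to second
   order at the point. *)
Lemma is_derive_mulmx0 {m n p} (M : R -> 'M[R]_(m, n)) (N : R -> 'M[R]_(n, p)) t :
  {for t, continuous M} -> N t = 0 -> is_derive t 1 N 0 ->
  is_derive t 1 (fun s => M s *m N s) 0.
Proof.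
move=> cM Nt /is_derive_mxP dN; apply/is_derive_mxP => i j.
have -> : (fun s => (M s *m N s) i j) =
    \sum_k ((fun s => M s i k) * (fun s => N s k j) : R -> R).
  by apply/funext => s; rewrite mxE fct_sumE.
rewrite mxE.
have d0 k : is_derive t 1 ((fun s => M s i k) * (fun s => N s k j) : R -> R) 0.
  (* By Caratheodory, the entry of [N] at [s] is [g s * (s - t)] with [g] continuous at [t] and
     [g t = 0]. The entry of [M] times [g] is then a slope function for the product, and it too
     vanishes at [t]. *)
  have := dN k j; rewrite mxE => /is_derive1_caratheodory[g [gE cg gt]].
  apply/is_derive1_caratheodory; exists (fun s => M s i k * g s); split.
  - move=> s; have := gE s; rewrite Nt mxE subr0 => Ns.
    by rewrite /= /GRing.mul/= Nt mxE Ns mulr0 subr0 mulrA.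
  - by apply: cvgM => //; exact: (continuous_mxP M t).1.
  - by rewrite gt mulr0.
apply: is_derive_eq.
by rewrite big1.
Qed.

End DerivativeOnInterval.

(** * Oriented integrals from 0 and the fundamental theorem of calculus *)

Section OrientedIntegral.
Context {R : realType}.
Notation mu := (@lebesgue_measure R).

Lemma continuous_integrable_itv (f : R -> R) (a b : R) :
  continuous f -> mu.-integrable `[a, b] (EFin \o f).
Proof.
move=> cf; apply: continuous_compact_integrable; first exact: segment_compact.
exact: continuous_subspaceT.
Qed.

Lemma integrable_patch_itvoo (f : R -> R) (a b : R) (D : set R) :
  measurable D -> continuous f -> mu.-integrable D (EFin \o (f \_ `]a, b[)).
Proof.
move=> mD cf; rewrite -restrict_EFin; apply/integrable_restrict => //.
apply: integrableS (continuous_integrable_itv a b cf) => //.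
  exact: measurableI.
by move=> s [_]; exact: subset_itvW.
Qed.

Lemma Rintegral_itvoo (f : R -> R) (c a b : R) : continuous f -> c <= a <= b ->
  \int[mu]_(s in `]a, b[) f s =
  \int[mu]_(s in `[c, b]) f s - \int[mu]_(s in `[c, a]) f s.
Proof.
move=> cf /andP[ca ab].
rewrite Rintegral_itvB//; last exact: continuous_integrable_itv.
rewrite Rintegral_itv_bndo_bndc//.
apply: integrableS (continuous_integrable_itv a b cf) => //.
exact: subset_itvW.
Qed.

(* The sign makes the integral of [oind t * f] the oriented integral of [f]
   from 0 to [t]. *)
Definition oind (t s : R) : R := (0 < s < t)%R%:R - (t < s < 0)%R%:R.

Lemma oind_ge0 (f : R -> R) t : 0 <= t ->
  (fun s => oind t s * f s) = f \_ `]0, t[.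
Proof.
move=> t0; apply/funext => s; rewrite patchE mem_setE in_itv/= /oind.
rewrite (_ : (t < s < 0) = false); last by apply/negP => /andP[]; lra.
by case: ifP => _; rewrite subr0 ?mul1r ?mul0r.
Qed.

Lemma oind_le0 (f : R -> R) t : t <= 0 ->
  (fun s => oind t s * f s) = fun s => - (f \_ `]t, 0[) s.
Proof.
move=> t0; apply/funext => s; rewrite patchE mem_setE in_itv/= /oind.
rewrite (_ : (0 < s < t) = false); last by apply/negP => /andP[]; lra.
by case: ifP => _; rewrite sub0r ?mulN1r ?oppr0 ?mul0r.
Qed.

Lemma integrable_oind (f : R -> R) t (D : set R) :
  measurable D -> continuous f ->
  mu.-integrable D (fun s => (oind t s * f s)%:E).
Proof.
move=> mD cf; have [t0|/ltW t0] := leP 0 t.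
  rewrite (_ : (fun s => _) = EFin \o (f \_ `]0, t[)).
    exact: integrable_patch_itvoo.
  by rewrite -(oind_ge0 f t0).
rewrite (_ : (fun s => _) = EFin \o (fun s => - (f \_ `]t, 0[) s)).
  apply: (@integrableN _ _ _ mu D (EFin \o (f \_ `]t, 0[))) => //.
  exact: integrable_patch_itvoo.
by rewrite -(oind_le0 f t0).
Qed.

(** Turns the oriented integral into a difference of integrals with one fixed lower limit. That
    limit, [- (T + 1)], lies strictly to the left of the interval, so that the right side is
    differentiable from both sides even at [t = - T]. *)
Lemma Rintegral_oind (f : R -> R) T t : continuous f -> t \in `[- T, T] ->
  \int[mu]_(s in `[- T, T]) (oind t s * f s) =
  \int[mu]_(s in `[- (T + 1), t]) f s - \int[mu]_(s in `[- (T + 1), 0]) f s.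
Proof.
move=> cf; rewrite in_itv/= => /andP[Tt tT].
have [t0|/ltW t0] := leP 0 t.
  rewrite (oind_ge0 f t0) -Rintegral_mkcondr -Rintegral_itvoo//; last lra.
  congr Rintegral; apply/setIidPr => s/=; rewrite !in_itv/= => /andP[? ?].
  by apply/andP; split; lra.
rewrite (oind_le0 f t0).
under eq_Rintegral do rewrite -mulN1r.
rewrite RintegralZl//; last exact: integrable_patch_itvoo.
rewrite -Rintegral_mkcondr mulN1r -[RHS]opprB -Rintegral_itvoo//; last lra.
congr (- Rintegral _ _ _); apply/setIidPr => s/=; rewrite !in_itv/= => /andP[? ?].
by apply/andP; split; lra.
Qed.

Lemma is_derive_Rintegral (f : R -> R) (c t : R) : continuous f -> c < t ->
  is_derive t 1 (fun x => \int[mu]_(s in `[c, x]) f s) (f t).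
Proof.
(* The bound [t + 1] only serves to have [t] inside an interval on which [f] is integrable. *)
move=> cf ct; have tu : t < t + 1 by rewrite ltrDl.
have [|df] := continuous_FTC1 tu (continuous_integrable_itv c (t + 1) cf) _ (cf t).
  by rewrite /= lte_fin.
by rewrite derive1E => ?; split.
Qed.

End OrientedIntegral.

(** * Integrals of vector functions, and changes on countable sets *)

Section VectorIntegral.
Context {R : realType}.
Notation mu := (@lebesgue_measure R).
Implicit Types (D : set R).

(** Meant for the finitely many points that the cases of [green] leave out. Measurability of [f]
    need not be assumed: every subset of a countable set is measurable, so it is inherited from
    [g]. *)
Lemma eq_integral_off_countable (f g : R -> R) D N :
  measurable D -> countable N ->
  (forall s, D s -> ~ N s -> f s = g s) -> mu.-integrable D (EFin \o g) ->
  mu.-integrable D (EFin \o f) /\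
  \int[mu]_(s in D) f s = \int[mu]_(s in D) g s.
Proof.
move=> mD cN fg ig.
have mN : measurable N by apply: countable_measurable.
have muN : mu N = 0%E by exact: countable_lebesgue_measure0.
have mg : measurable_fun D g by apply/measurable_EFinP; exact: measurable_int ig.
have mf : measurable_fun D f.
  (* Off [N] the preimage under [f] is the one under [g]; inside [N] it is countable. *)
  move=> _ B mB; rewrite (_ : D `&` _ =
      ((D `&` g @^-1` B) `\` N) `|` (D `&` f @^-1` B `&` N)).
    apply: measurableU; first by apply: measurableD => //; exact: mg.
    apply: countable_measurable => //; apply: sub_countable cN.
    by apply: subset_card_le; exact: subIsetr.
  apply/seteqP; split => s /=.
    move=> [Ds Bs]; have [Ns|Ns] := pselect (N s); [by right|left].
    by split => //; split => //; rewrite -fg.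
  by move=> [[[Ds Bs] Ns]|[[]]//]; split => //; rewrite fg.
have mEf : measurable_fun D (EFin \o f) by exact/measurable_EFinP.
split.
  apply: (@negligible_integrable _ _ _ mu _ _ _ mN mD mEf muN).2.
  have := (@negligible_integrable _ _ _ mu _ _ _ mN mD (measurable_int _ ig) muN).1 ig.
  by apply: eq_integrable; [exact: measurableD|move=> s /set_mem[Ds Ns]/=; rewrite fg].
congr fine; apply: ae_eq_integral => //; first exact: measurable_int ig.
exists N; split => // s /= /not_implyP[Ds fgs]; apply: contrapT => Ns.
by apply: fgs; rewrite fg.
Qed.

Lemma eq_integral_vec_off_countable {n} (f g : R -> 'cV[R]_n) D N :
  measurable D -> countable N ->
  (forall s, D s -> ~ N s -> f s = g s) -> integrable_vec D g ->
  integrable_vec D f /\ integral_vec D f = integral_vec D g.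
Proof.
move=> mD cN fg ig.
have H i : mu.-integrable D (EFin \o (fun s => f s i 0)) /\
    \int[mu]_(s in D) f s i 0 = \int[mu]_(s in D) g s i 0.
  apply: (eq_integral_off_countable mD cN) => [s Ds Ns|]; first by rewrite fg.
  exact: ig.
split=> [i|]; first exact: (H i).1.
by apply/colP => i; rewrite !mxE (H i).2.
Qed.

Lemma integral_vecD {n} (f g : R -> 'cV[R]_n) D : measurable D ->
  integrable_vec D f -> integrable_vec D g ->
  integrable_vec D (fun s => f s + g s) /\
  integral_vec D (fun s => f s + g s) = integral_vec D f + integral_vec D g.
Proof.
move=> mD intf intg; split=> [i|].
  have := @integrableD _ _ _ mu D mD _ _ (intf i) (intg i).
  apply: eq_integrable => // s _ /=.
  by rewrite mxE EFinD.
apply/colP => i; rewrite !mxE; under eq_Rintegral do rewrite mxE.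
exact: (@RintegralD _ _ _ mu D _ _ mD (intf i) (intg i)).
Qed.

Lemma integral_vec_mulmx {m n} (M : 'M[R]_(m, n)) (f : R -> 'cV[R]_n) D :
  measurable D -> integrable_vec D f ->
  integrable_vec D (fun s => M *m f s) /\
  integral_vec D (fun s => M *m f s) = M *m integral_vec D f.
Proof.
move=> mD intf.
have iZ i k : mu.-integrable D (fun s => (M i k)%:E * (f s k 0)%:E)%E.
  exact: (@integrableZl _ _ _ mu D mD).
have fE i : (fun s => ((M *m f s) i 0)%:E) =
    (fun s => \sum_k (M i k)%:E * (f s k 0)%:E)%E.
  by apply/funext => s; rewrite mxE -sumEFin; apply: eq_bigr.
split=> [i|]; first by rewrite fE; exact: (@integrable_sum _ _ _ mu D mD).
have ifin k : (\int[mu]_(s in D) (f s k 0)%:E)%E \is a fin_num.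
  exact: (@integrable_fin_num _ _ _ mu D mD _ (intf k)).
apply/colP => i; rewrite !mxE /Rintegral fE (@integral_sum _ _ _ mu D mD)//.
under eq_bigr => k _ do rewrite (@integralZl _ _ _ mu D mD _ (intf k)).
rewrite -sum_fine; last by move=> k _; rewrite fin_numM.
by apply: eq_bigr => k _; rewrite mxE /Rintegral fineM.
Qed.

End VectorIntegral.

(** * Oriented integrals of vector functions *)

Section VectorOrientedIntegral.
Context {R : realType} {n : nat}.
Implicit Types (f : R -> 'cV[R]_n).

Lemma integrable_vec_oind f t (D : set R) : measurable D -> continuous f ->
  integrable_vec D (fun s => oind t s *: f s).
Proof.
move=> mD cf i; have cfi : continuous (fun s => f s i 0).
  by move=> s; exact: (continuous_mxP f s).1 (cf s) i 0.
rewrite (_ : (fun s => _) = fun s => (oind t s * f s i 0)%:E).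
  exact: (integrable_oind t mD cfi).
by apply/funext => s; rewrite mxE.
Qed.

Lemma integral_vec_oind f T t : continuous f -> t \in `[- T, T] ->
  integral_vec `[- T, T] (fun s => oind t s *: f s) =
  integral_vec `[- (T + 1), t] f - integral_vec `[- (T + 1), 0] f.
Proof.
move=> cf tT; apply/colP => i; rewrite !mxE -Rintegral_oind//.
  by under eq_Rintegral do rewrite mxE.
by move=> s; exact: (continuous_mxP f s).1 (cf s) i 0.
Qed.

Lemma is_derive_integral_vec f (c t : R) : continuous f -> c < t ->
  is_derive t 1 (fun x => integral_vec `[c, x] f) (f t).
Proof.
move=> cf ct; apply/is_derive_mxP => i j; rewrite [j]ord1.
rewrite (_ : (fun x => _) =
  fun x => \int[@lebesgue_measure R]_(s in `[c, x]) f s i 0).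
  apply: (@is_derive_Rintegral _ (fun s => f s i 0)) => // s.
  exact: (continuous_mxP f s).1 (cf s) i 0.
by apply/funext => x; rewrite mxE.
Qed.

End VectorOrientedIntegral.

(** * The effect of the reflection of time on [calX] *)

Section Reflection.
Context {R : realType} {n : nat}.

Definition reflect_mx : 'M[R]_(n + n) := block_mx 1%:M 0 0 (- 1%:M).

Lemma reflect_mxK : reflect_mx *m reflect_mx = 1%:M.
Proof.
rewrite /reflect_mx mulmx_block !mulmx0 !mul0mx !mulmx1 !addr0 add0r.
by rewrite mulmxN mulmx1 opprK -scalar_mx_block.
Qed.

Lemma mul_reflect_col_mx m (M N : 'M[R]_(n, m)) :
  reflect_mx *m col_mx M N = col_mx M (- N).
Proof. by rewrite mul_block_col !mul0mx mul1mx mulNmx mul1mx addr0 add0r. Qed.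

(** Even parts fill the diagonal blocks and odd parts the others; conjugation by [reflect_mx]
    changes the sign of exactly the off-diagonal blocks. *)
Lemma calXN (X Y : R -> 'M[R]_n) t :
  calX X Y (- t) = reflect_mx *m calX X Y t *m reflect_mx.
Proof.
rewrite /calX /reflect_mx !mulmx_block !(mul0mx, mulmx0, mul1mx, mulmx1, addr0, add0r).
rewrite !(mulNmx, mulmxN, mul1mx, mulmx1, opprK) /even_part /odd_part opprK.
by congr block_mx; rewrite -?scalerN ?opprB// addrC.
Qed.

Lemma invmx_calXN_Vminus (F G : 'M[R]_n) (X Y : R -> 'M[R]_n) t :
  calX X Y t \in unitmx ->
  invmx (calX X Y (- t)) *m Vminus F G =
  - (reflect_mx *m (invmx (calX X Y t) *m Vplus F G)).
Proof.
(* [N] is an explicit inverse at [- t], which also proves invertibility there. The reflection then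
   turns [Vplus] into minus [Vminus]. *)
move=> uX; pose N := reflect_mx *m invmx (calX X Y t) *m reflect_mx.
have XN : calX X Y (- t) *m N = 1%:M.
  rewrite /N calXN -!mulmxA (mulmxA reflect_mx reflect_mx) reflect_mxK mul1mx.
  by rewrite (mulmxA (calX _ _ _)) mulmxV// mul1mx reflect_mxK.
have uXN : calX X Y (- t) \in unitmx by case/mulmx1_unit: XN.
have -> : invmx (calX X Y (- t)) = N by rewrite -[LHS]mulmx1 -XN mulKmx.
rewrite /N -!mulmxA mul_reflect_col_mx -!mulmxN; congr (_ *m (_ *m _)).
by rewrite /Vplus opp_col_mx.
Qed.

End Reflection.

(** * The ordinary differential system for the even and odd parts *)

Section ReducedSystem.
Context {R : realType} {n : nat}.
Implicit Types (F G A B : 'M[R]_n).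

(** The coefficient matrix obtained by solving the homogeneous system for the derivatives of the
    even part (upper block) and odd part (lower block). *)
Definition reduced_mx F G A B : 'M[R]_(n + n) :=
  block_mx 0 (- (invmx (F - G) *m (A - B))) (- (invmx (F + G) *m (A + B))) 0.

Lemma is_derive_parts {m} F G A B (d : R -> 'M[R]_(n, m)) (t : R) a b :
  F - G \in unitmx -> F + G \in unitmx ->
  is_derive t 1 d a -> is_derive (- t) 1 d b ->
  F *m a + G *m b + A *m d t + B *m d (- t) = 0 ->
  F *m b + G *m a + A *m d (- t) + B *m d t = 0 ->
  is_derive t 1 (even_part d) (- (invmx (F - G) *m (A - B)) *m odd_part d t) /\
  is_derive t 1 (odd_part d) (- (invmx (F + G) *m (A + B)) *m even_part d t).
Proof.
move=> uB uD da db ab ba.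
(* The difference of the equations at [t] and [- t] involves only the derivative of the even part
   and the odd part; their sum, below, involves the other two. *)
have odd_eq : (F - G) *m (a - b) + (A - B) *m (d t - d (- t)) = 0.
  transitivity ((F *m a + G *m b + A *m d t + B *m d (- t)) -
    (F *m b + G *m a + A *m d (- t) + B *m d t)); last by rewrite ab ba subrr.
  rewrite !mulmxBl !mulmxBr; apply/matrixP => i j; rewrite !mx_linE; ring.
have even_eq : (F + G) *m (a + b) + (A + B) *m (d t + d (- t)) = 0.
  transitivity ((F *m a + G *m b + A *m d t + B *m d (- t)) +
    (F *m b + G *m a + A *m d (- t) + B *m d t)); last by rewrite ab ba addr0.
  rewrite !mulmxDl !mulmxDr; apply/matrixP => i j; rewrite !mx_linE; ring.
split.
- apply: is_derive_eq; first exact: is_derive_even_part da db.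
  rewrite /odd_part -scalemxAr mulNmx -mulmxA; congr (_ *: _).
  by rewrite -[_ *m (d t - _)]opprK -(addr0_eq odd_eq) opprK mulmxN opprK mulKmx.
- apply: is_derive_eq; first exact: is_derive_odd_part da db.
  rewrite /even_part -scalemxAr mulNmx -mulmxA; congr (_ *: _).
  by rewrite -[_ *m (d t + _)]opprK -(addr0_eq even_eq) opprK mulmxN opprK mulKmx.
Qed.

Lemma is_derive_col_parts {m} F G A B (d : R -> 'M[R]_(n, m)) (t : R) a b :
  F - G \in unitmx -> F + G \in unitmx ->
  is_derive t 1 d a -> is_derive (- t) 1 d b ->
  F *m a + G *m b + A *m d t + B *m d (- t) = 0 ->
  F *m b + G *m a + A *m d (- t) + B *m d t = 0 ->
  is_derive t 1 (fun s => col_mx (even_part d s) (odd_part d s))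
    (reduced_mx F G A B *m col_mx (even_part d t) (odd_part d t)).
Proof.
move=> uB uD da db ab ba.
have [de do_] := is_derive_parts uB uD da db ab ba.
by rewrite mul_block_col !mul0mx add0r addr0; exact: is_derive_col_mx.
Qed.

Lemma homogeneous_solution_is_derive {m} F G A B (u : R -> 'M[R]_(n, m)) (t : R) :
  homogeneous_solution F G A B u -> is_derive t 1 u (u^`()%classic t).
Proof. by move=> [du _]; rewrite derive1E; exact: derivableP. Qed.

(** Changing the signs of [G] and [B] exchanges [F - G] with [F + G] and [A - B] with [A + B]. Hence
    [Y] gives solutions of the same reduced system once its odd part is put on top, as in the second
    block column of [calX]. *)
Lemma is_derive_calX F G A B (X Y : R -> 'M[R]_n) (t : R) :
  F - G \in unitmx -> F + G \in unitmx ->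
  homogeneous_solution F G A B X -> homogeneous_solution F (- G) A (- B) Y ->
  is_derive t 1 (calX X Y) (reduced_mx F G A B *m calX X Y t).
Proof.
move=> uB uD hX hY.
have dX s := homogeneous_solution_is_derive s hX.
have dY s := homogeneous_solution_is_derive s hY.
have -> : calX X Y = fun s => row_mx (col_mx (even_part X s) (odd_part X s))
    (col_mx (odd_part Y s) (even_part Y s)).
  by apply/funext => s; rewrite /calX block_mxEh.
rewrite mul_mx_row; apply: is_derive_row_mx.
  apply: is_derive_col_parts (dX t) (dX (- t)) _ _ => //; first exact: hX.2.
  by have := hX.2 (- t); rewrite opprK.
have [|||dYe dYo] := is_derive_parts _ _ (dY t) (dY (- t)) (hY.2 t) _.
- by rewrite opprK.
- by [].
- by have := hY.2 (- t); rewrite opprK.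
rewrite mul_block_col !mul0mx add0r addr0; apply: is_derive_col_mx => //.
by move: dYe; rewrite !opprK.
Qed.

(** Clamping the argument makes the matrix invertible at every real [s], as [continuous_invmx]
    requires. *)
Lemma continuous_invmx_calX F G A B (X Y : R -> 'M[R]_n) T :
  0 < T -> F - G \in unitmx -> F + G \in unitmx ->
  homogeneous_solution F G A B X -> homogeneous_solution F (- G) A (- B) Y ->
  (forall t, t \in `[- T, T] -> calX X Y t \in unitmx) ->
  continuous (fun s => invmx (calX X Y (clamp T s))).
Proof.
move=> T0 uB uD hX hY uX s.
apply: (@continuous_invmx _ _ _ (fun r => calX X Y (clamp T r))).
  by move=> r; exact/uX/clamp_itv.
apply: continuous_comp; first exact: continuous_clamp.
apply: differentiable_continuous; apply/derivable1_diffP.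
by have [] := is_derive_calX (clamp T s) uB uD hX hY.
Qed.

(* [calX^-1 (d_e; d_o)] has derivative zero. *)
Lemma reduced_solution F G A B (X Y : R -> 'M[R]_n) T (d d' : R -> 'cV[R]_n) :
  0 < T -> F - G \in unitmx -> F + G \in unitmx ->
  homogeneous_solution F G A B X -> homogeneous_solution F (- G) A (- B) Y ->
  (forall t, t \in `[- T, T] -> calX X Y t \in unitmx) ->
  continuous d ->
  (forall t, t \in `]- T, T[ -> is_derive t 1 d (d' t)) ->
  (forall t, t \in `]- T, T[ ->
    F *m d' t + G *m d' (- t) + A *m d t + B *m d (- t) = 0) ->
  exists c, forall t, t \in `[- T, T] ->
    col_mx (even_part d t) (odd_part d t) = calX X Y t *m c.
Proof.
move=> T0 uB uD hX hY uX cd dd ed.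
pose E s := col_mx (even_part d s) (odd_part d s).
pose Xi s := invmx (calX X Y (clamp T s)).
pose p s := Xi s *m E s.
have T00 : 0 \in `[- T, T] by rewrite in_itv/= oppr_le0 ltW.
have cXi : continuous Xi := continuous_invmx_calX T0 uB uD hX hY uX.
have cdN : continuous (fun s => d (- s)).
  by move=> s; apply: (@continuous_comp _ _ _ -%R d); [exact: opp_continuous|exact: cd].
have cE : continuous E.
  move=> s; apply: continuous_col_mx; apply: cvgZ; (try exact: cvg_cst).
    by apply: cvgD; [exact: cd|exact: cdN].
  by apply: cvgB; [exact: cd|exact: cdN].
have cp : continuous p by move=> s; apply: continuous_mulmx; [exact: cXi|exact: cE].
have dp t : t \in `]- T, T[ -> is_derive t 1 p 0.
  move=> tT; have tT' : t \in `[- T, T].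
    by move: tT; rewrite !in_itv/= => /andP[/ltW-> /ltW->].
  have tTN : - t \in `]- T, T[ 
    by move: tT; rewrite !in_itv/= => /andP[? ?]; apply/andP; split; lra.
  have dE : is_derive t 1 E (reduced_mx F G A B *m E t).
    apply: is_derive_col_parts (dd _ tT) (dd _ tTN) _ _ => //; first exact: ed.
    by have := ed _ tTN; rewrite opprK.
  (* Freezing [p] at [t] avoids differentiating the inverse: near [t], [p s = Xi s *m N s + p t],
     where [N] vanishes at [t] together with its derivative because [E] and [calX] obey the same
     linear equation. *)
  pose N s := E s - calX X Y s *m p t.
  have Et : E t = calX X Y t *m p t by rewrite /p /Xi clamp_id// mulKVmx// uX.
  have Nt : N t = 0 by rewrite /N Et subrr.
  have dN : is_derive t 1 N 0.
    apply: is_derive_eq.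
      exact: is_deriveB dE (is_derive_mulmxr (p t) (is_derive_calX t uB uD hX hY)).
    by rewrite Et mulmxA subrr.
  have := is_derive_mulmx0 (cXi t) Nt dN => dXN.
  have dXN' : is_derive t 1 (fun s => Xi s *m N s + p t) 0.
    by apply: is_derive_eq; rewrite addr0.
  apply: near_eq_is_derive dXN'; have := near_clamp tT; apply: filterS => s sT.
  rewrite /N mulmxBr /Xi sT mulKmx; first by rewrite subrK /p /Xi sT.
  by apply: uX; rewrite -sT clamp_itv.
exists (p 0) => t tT; rewrite -[LHS](mulKVmx (uX _ tT)); congr (_ *m _).
apply/colP => i.
have -> : (invmx (calX X Y t) *m col_mx (even_part d t) (odd_part d t)) = p t.
  by rewrite /p /Xi clamp_id.
apply: (@cst_of_is_derive0 _ (fun s => p s i 0) T) => // [s|r rT].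
  exact: (continuous_mxP p s).1 (cp s) i 0.
by have /is_derive_mxP/(_ i 0) := dp _ rT; rewrite mxE.
Qed.

End ReducedSystem.

(** * The six cases of the Green's function in one formula *)

Section GreenFunction.
Context {R : realType} {n : nat}.
Implicit Types (F G A B C K : 'M[R]_n) (X Y : R -> 'M[R]_n).

(** [W r] is the integrand of the variation-of-parameters integral from 0 to [r], with the reflected
    half written over [- r]. The case distinction only records the values of the oriented indicators
    at [t], [T] and [- T]. *)
Lemma green_oind T F G C K X Y t s (g : 'cV[R]_n) :
  t \in `[- T, T] -> s \in `]- T, T[ -> s != 0 -> s != t -> s != - t ->
  let a := invmx (calX X Y s) *m Vplus F G *m g in
  let b := invmx (calX X Y (- s)) *m Vminus F G *m g in
  let W r := 2^-1 *: (oind r s *: a - oind (- r) s *: b) in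
  green T F G C K X Y t s *m g =
  Zmx X Y t *m W t - GammaK T C K X Y t *m W T - GammaC T C K X Y t *m W (- T).
Proof.
rewrite !in_itv/= => /andP[Tt tT] /andP[Ts sT] s0 st sNt.
set Z := Zmx X Y t; set GK := GammaK _ _ _ _ _ _; set GC := GammaC _ _ _ _ _ _.
rewrite /green -/Z -/GK -/GC.
set P := invmx _ *m Vplus _ _; set Q := invmx _ *m Vminus _ _.
(* Reduces the claim to comparing the scalar coefficients of the six products of [Z], [GK], [GC]
   with [P], [Q]. *)
have lin (L : 'M[R]_n) (x y z x' y' z' : R) :
    L = x *: (Z *m P) - y *: (GK *m P) - z *: (GC *m P) -
      (x' *: (Z *m Q) - y' *: (GK *m Q) - z' *: (GC *m Q)) ->
    (2^-1 *: L) *m g =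
    Z *m (2^-1 *: (x *: (P *m g) - x' *: (Q *m g))) -
    GK *m (2^-1 *: (y *: (P *m g) - y' *: (Q *m g))) -
    GC *m (2^-1 *: (z *: (P *m g) - z' *: (Q *m g))).
  move=> ->; rewrite -scalemxAl -!scalemxAr !mulmxBl !mulmxBr -!scalemxAr.
  rewrite -!scalemxAl !mulmxA -!scalerBr; congr (_ *: _).
  have sumB (p1 p2 p3 q1 q2 q3 : 'cV[R]_n) :
      p1 - p2 - p3 - (q1 - q2 - q3) = p1 - q1 - (p2 - q2) - (p3 - q3).
    by apply/colP => i; rewrite !mx_linE; ring.
  exact: sumB.
apply: (lin _ (oind t s) (oind T s) (oind (- T) s)
  (oind (- t) s) (oind (- T) s) (oind (- - T) s)).
rewrite /oind !opprK !ltr_norml oppr_gt0 !opprK ltrN2.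
rewrite (ltrNl s t) (ltrNr t s) sT Ts ![s < - T]lt_gtF ?[T < s]lt_gtF//.
(* Of the eight strict orderings of [s] against 0, [t] and [- t], two are contradictory; the other
   six are the cases of [green]. *)
move: s0 st sNt; case: (ltgtP s 0) => // hs _; case: (ltgtP s t) => // ht _;
  case: (ltgtP s (- t)) => // hNt _; try (exfalso; lra).
all: rewrite /= ?mulmxDl ?mulmxBl ?mulNmx.
all: by apply/matrixP => i j; rewrite !mx_linE; ring.
Qed.

End GreenFunction.

(** * Algebra of variation of parameters, and uniqueness *)

Section BoundaryValueProblem.
Context {R : realType} {n : nat}.
Variables (T : R) (F G A B C K : 'M[R]_n) (X Y : R -> 'M[R]_n).
Hypotheses (T_gt0 : 0 < T)
  (FBG_unit : F - G \in unitmx) (FDG_unit : F + G \in unitmx)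
  (hX : homogeneous_solution F G A B X)
  (hY : homogeneous_solution F (- G) A (- B) Y)
  (calX_unit : forall t : R, t \in `[- T, T] -> calX X Y t \in unitmx)
  (MX_unit : MX T C K X \in unitmx).

Lemma oppr_in_itv (t : R) : t \in `[- T, T] -> - t \in `[- T, T].
Proof. by rewrite !in_itv/= => /andP[? ?]; apply/andP; split; lra. Qed.

(** A function is the sum of its parts. This lets the inverse of [calX] cancel when [Z w] is
    differentiated. *)
Lemma Zmx_calX t : Zmx X Y t = row_mx 1%:M 1%:M *m calX X Y t.
Proof.
rewrite mul_row_block !mul1mx /Zmx /even_part /odd_part -!scalerDr.
by congr row_mx; apply/matrixP => i j; rewrite !mx_linE; field.
Qed.

(** For [x = gamma t] and [y = gamma (- t)], [a x y] is the contribution of [Z w'] to the derivative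
    of the solution at [t], and [a y x] the one at [- t]; together they must produce [gamma t]. *)
Lemma source_term (x y : 'cV[R]_n) :
  let a x y := 2^-1 *: (row_mx 1%:M 1%:M *m (Vplus F G *m x + Vminus F G *m y)) in
  F *m a x y + G *m a y x = x.
Proof.
move=> a.
have aE r s : a r s =
    2^-1 *: (invmx (F - G) *m (r - s) + invmx (F + G) *m (r + s)).
  rewrite /a mulmxDr !mulmxA !mul_row_col !mul1mx; congr (_ *: _).
  rewrite mulmxBr mulmxDr !mulmxDl mulNmx.
  by apply/colP => i; rewrite !mx_linE; ring.
(* Exchanging [x] and [y] changes the sign of [H] and fixes [L]. *)
set H := invmx (F - G) *m (x - y); set L := invmx (F + G) *m (x + y).
have eH : F *m H - G *m H = x - y by rewrite -mulmxBl mulKVmx.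
have eL : F *m L + G *m L = x + y by rewrite -mulmxDl mulKVmx.
have -> : a x y = 2^-1 *: (H + L) by rewrite aE.
have -> : a y x = 2^-1 *: (L - H).
  by rewrite aE addrC (addrC y) -/L -[y - x]opprB mulmxN.
rewrite -!scalemxAr -scalerDr mulmxDr mulmxBr.
have -> : F *m H + F *m L + (G *m L - G *m H) =
    (F *m H - G *m H) + (F *m L + G *m L).
  by apply/colP => i; rewrite !mx_linE; ring.
by rewrite eH eL; apply/colP => i; rewrite !mx_linE; field.
Qed.

(** Index 1 stands for derivatives, 0 for values, and a prime for evaluation at [- t]. There the
    lower half of [w] changes sign, which matches the signs of [G] and [B] in the system of [Y], so
    all terms without [a] cancel. *)
Lemma homogeneous_combination (X1 X1' X0 X0' Y1 Y1' Y0 Y0' : 'M[R]_n)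
    (c w1 w2 a a' : 'cV[R]_n) :
  F *m X1 + G *m X1' + A *m X0 + B *m X0' = 0 ->
  F *m Y1 + - G *m Y1' + A *m Y0 + - B *m Y0' = 0 ->
  F *m (X1 *m c + (row_mx X1 Y1 *m col_mx w1 w2 + a)) +
  G *m (X1' *m c + (row_mx X1' Y1' *m col_mx w1 (- w2) + a')) +
  A *m (X0 *m c + row_mx X0 Y0 *m col_mx w1 w2) +
  B *m (X0' *m c + row_mx X0' Y0' *m col_mx w1 (- w2)) = F *m a + G *m a'.
Proof.
move=> eX eY.
have term (M N L : 'M[R]_n) (v : 'cV[R]_n) :
    M *m (N *m c + row_mx N L *m col_mx w1 v) =
    M *m N *m (c + w1) + M *m L *m v.
  by rewrite mul_row_col !mulmxDr !mulmxA !addrA.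
have sum4 (p1 p2 p3 p4 q1 q2 q3 q4 r1 r2 : 'cV[R]_n) :
    p1 + q1 + r1 + (p2 + q2 + r2) + (p3 + q3) + (p4 + q4) =
    (p1 + p2 + p3 + p4) + (q1 + q2 + q3 + q4) + (r1 + r2).
  by apply/colP => i; rewrite !mx_linE; ring.
rewrite !addrA (mulmxDr F) (mulmxDr G) !term sum4 -!mulmxDl eX mul0mx add0r.
by rewrite !mulmxN -!mulNmx -!mulmxDl eY mul0mx add0r.
Qed.

(** The difference [d] of two solutions has parts [calX t *m c]. At 0 its odd part vanishes, which
    kills the lower half of [c]; then [d = X c1], and the boundary condition gives [M_X c1 = 0]. *)
Lemma bvp_solution_unique gamma delta u v :
  bvp_solution T F G A B C K gamma delta u ->
  bvp_solution T F G A B C K gamma delta v ->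
  forall t, t \in `[- T, T] -> v t = u t.
Proof.
move=> [du eu bu] [dv ev bv].
pose d := (fun s => v s - u s) \o clamp T.
have oocc (t : R) : t \in `]- T, T[ -> t \in `[- T, T].
  by rewrite !in_itv/= => /andP[/ltW-> /ltW->].
have dE t : t \in `[- T, T] -> d t = v t - u t.
  by move=> tT; rewrite /d/= clamp_id.
have cd : continuous d.
  apply: continuous_comp_clamp => // t tT.
  by apply: cvgB; apply: derivable_on_continuous; [exact: dv|exact: du].
have dd t : t \in `]- T, T[ ->
    is_derive t 1 d (derive_on `[- T, T] v t - derive_on `[- T, T] u t).
  move=> tT; have dvu := is_deriveB (derivable_on_is_derive tT (dv _ (oocc _ tT)))
    (derivable_on_is_derive tT (du _ (oocc _ tT))).
  apply: near_eq_is_derive dvu; have := near_clamp tT.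
  by apply: filterS => s sT; rewrite /d/= sT.
have ed t : t \in `]- T, T[ ->
    F *m (derive_on `[- T, T] v t - derive_on `[- T, T] u t) +
    G *m (derive_on `[- T, T] v (- t) - derive_on `[- T, T] u (- t)) +
    A *m d t + B *m d (- t) = 0.
  move=> /oocc tT; rewrite !dE ?oppr_in_itv// !mulmxBr.
  have sumB (p1 p2 p3 p4 q1 q2 q3 q4 : 'cV[R]_n) : (p1 - q1) + (p2 - q2) +
      (p3 - q3) + (p4 - q4) = (p1 + p2 + p3 + p4) - (q1 + q2 + q3 + q4).
    by apply/colP => i; rewrite !mx_linE; ring.
  by rewrite sumB (ev _ tT) (eu _ tT) subrr.
have [c cE] := reduced_solution T_gt0 FBG_unit FDG_unit hX hY calX_unit cd dd ed.
have T00 : 0 \in `[- T, T] by rewrite in_itv/= oppr_le0 ltW.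
have TT : T \in `[- T, T] by rewrite in_itv/= lexx andbT; move: T_gt0; lra.
have NT : - T \in `[- T, T] by exact: oppr_in_itv.
have YE : even_part Y 0 = Y 0.
  by apply/matrixP => i j; rewrite /even_part oppr0 !mx_linE; field.
(* At 0 the odd parts vanish, so [calX] is block diagonal with [Y 0] as lower block. *)
have Y0_unit : Y 0 \in unitmx.
  have := calX_unit T00; rewrite /calX /odd_part oppr0 !subrr !scaler0.
  by rewrite YE !unitmxE det_ublock unitrM => /andP[].
have c2 : dsubmx c = 0.
  have := cE _ T00; rewrite /calX /odd_part oppr0 !subrr !scaler0 YE.
  rewrite -[c]vsubmxK mul_block_col !mul0mx add0r col_mxKd => /eq_col_mx[_ /esym].
  by move=> /(congr1 (mulmx (invmx (Y 0)))); rewrite mulKmx// mulmx0.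
have dX t : t \in `[- T, T] -> d t = X t *m usubmx c.
  move=> tT; have <- : row_mx 1%:M 1%:M *m
      col_mx (even_part d t) (odd_part d t) = X t *m usubmx c.
    rewrite cE// mulmxA -Zmx_calX -[in LHS](vsubmxK c) c2 mul_row_col.
    by rewrite mulmx0 addr0.
  rewrite mul_row_col !mul1mx.
  by apply/colP => i; rewrite !mx_linE; field.
have c1 : usubmx c = 0.
  have : MX T C K X *m usubmx c = 0.
    rewrite /MX mulmxDl -!mulmxA -!dX// !dE// !mulmxBr addrACA -opprD bv bu.
    by rewrite subrr.
  by move=> /(congr1 (mulmx (invmx (MX T C K X)))); rewrite mulKmx// mulmx0.
by move=> t tT; apply/eqP; rewrite -subr_eq0 -dE// dX// c1 mulmx0.
Qed.

End BoundaryValueProblem.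

(** * Existence by variation of parameters, and the integral representation *)

Theorem theorem6p4 (R : realType) (n : nat) (T : R) (A B C F G K : 'M[R]_n)
    (gamma : R -> 'cV[R]_n) (delta : 'cV[R]_n) (X Y : R -> 'M[R]_n)
    (T_gt0 : 0 < T)
    (FBG_unit : F - G \in unitmx) (FDG_unit : F + G \in unitmx)
    (gamma_cont : {within `[- T, T], continuous gamma})
    (X_fund : fundamental_matrix F G A B X)
    (Y_fund : fundamental_matrix F (- G) A (- B) Y)
    (calX_unit : forall t : R, t \in `[- T, T] -> calX X Y t \in unitmx)
    (MX_unit : MX T C K X \in unitmx) :
  exists u : R -> 'cV[R]_n,
    [/\ bvp_solution T F G A B C K gamma delta u,
        forall v : R -> 'cV[R]_n, bvp_solution T F G A B C K gamma delta v ->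
          forall t : R, t \in `[- T, T] -> v t = u t &
        forall t : R, t \in `[- T, T] ->
          integrable_vec `[- T, T] (fun s => green T F G C K X Y t s *m gamma s)
          /\ u t = X t *m invmx (MX T C K X) *m delta
                   + integral_vec `[- T, T]
                       (fun s => green T F G C K X Y t s *m gamma s)].
Proof.
have [_ hX _ _] := X_fund; have [_ hY _ _] := Y_fund.
have memN (t : R) : t \in `[- T, T] -> - t \in `[- T, T] := @oppr_in_itv R T t.
have TT : T \in `[- T, T] by rewrite in_itv/= lexx andbT; lra.
have NT : - T \in `[- T, T] by exact: memN.
pose J : 'M[R]_(n + n) := reflect_mx.
pose p s := invmx (calX X Y (clamp T s)) *m (Vplus F G *m gamma (clamp T s)).
have cp : continuous p.
  move=> s; apply: (@continuous_mulmx _ _ _ _ _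
    (fun r => invmx (calX X Y (clamp T r)))
    (fun r => Vplus F G *m gamma (clamp T r))).
    exact: (continuous_invmx_calX T_gt0 FBG_unit FDG_unit hX hY calX_unit).
  apply: (@continuous_mulmx _ _ _ _ _ (cst (Vplus F G)) (gamma \o clamp T)).
    exact: cvg_cst.
  apply: (continuous_comp_clamp T_gt0) => t tT.
  exact: (subspace_continuousP _ gamma).1 gamma_cont t tT.
pose P t := integral_vec `[- (T + 1), t] p - integral_vec `[- (T + 1), 0] p.
pose w t := 2^-1 *: (P t + J *m P (- t)).
(* The [W] of [green_oind], with its vector [b] rewritten as [- (J *m p s)]; its integral over the
   interval is [w r]. *)
pose W r s := 2^-1 *: (oind r s *: p s - oind (- r) s *: - (J *m p s)).
have mI : measurable (`[- T, T]%classic : set R) by [].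
have iW r : r \in `[- T, T] -> integrable_vec `[- T, T] (W r) /\
    integral_vec `[- T, T] (W r) = w r.
  move=> rT.
  have [i1 e1] := integral_vec_mulmx (2^-1)%:M mI (integrable_vec_oind r mI cp).
  have [i2 e2] :=
    integral_vec_mulmx (2^-1 *: J) mI (integrable_vec_oind (- r) mI cp).
  have [i3 e3] := integral_vecD mI i1 i2.
  have -> : W r = fun s => (2^-1)%:M *m (oind r s *: p s) +
      (2^-1 *: J) *m (oind (- r) s *: p s).
    apply/funext => s; rewrite /W mul_scalar_mx -scalemxAl -scalemxAr -scalerDr.
    by rewrite scalerN opprK.
  split=> //; rewrite e3 e1 e2 !integral_vec_oind ?memN//.
  by rewrite mul_scalar_mx -scalemxAl -scalerDr.
(* This is the sign change in the lower half of [w] that [homogeneous_combination] expects. *)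
have wN r : w (- r) = J *m w r.
  by rewrite /w opprK -scalemxAr (mulmxDr J (P r)) mulmxA reflect_mxK mul1mx addrC.
have dw t : t \in `[- T, T] -> is_derive t 1 w (invmx (calX X Y t) *m
    (2^-1 *: (Vplus F G *m gamma t + Vminus F G *m gamma (- t)))).
  move=> tT; have tNT := memN _ tT.
  have dP (s : R) : s \in `[- T, T] -> is_derive s 1 P (p s).
    rewrite in_itv/= => /andP[Ts _]; rewrite -[p s]subr0.
    apply: is_deriveB; apply: is_derive_integral_vec => //; lra.
  apply: is_derive_eq.
    apply: is_deriveZ; apply: is_deriveD; first exact: dP.
    by apply: is_derive_mulmxl; apply: is_derive_mx_oppr; exact: dP.
  rewrite -scalemxAr; congr (_ *: _).
  rewrite mulmxDr /p !clamp_id//; congr (_ + _).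
  (* The reflection identity at [- t] converts [- J p(-t)], from differentiating [P (- t)], into the
     [Vminus] term at [t]. *)
  have := invmx_calXN_Vminus F G (calX_unit _ tNT); rewrite opprK => VE.
  by rewrite [RHS]mulmxA VE mulmxN mulNmx !mulmxA.
pose M := MX T C K X.
(* Obtained by solving the boundary condition of [X c + Z w] for [c]. *)
pose c := invmx M *m (delta - K *m Zmx X Y T *m w T - C *m Zmx X Y (- T) *m w (- T)).
pose u t := X t *m c + Zmx X Y t *m w t.
pose a (x y : 'cV[R]_n) : 'cV[R]_n :=
  2^-1 *: (row_mx 1%:M 1%:M *m (Vplus F G *m x + Vminus F G *m y)).
pose u' t := X^`()%classic t *m c +
  (row_mx (X^`()%classic t) (Y^`()%classic t) *m w t + a (gamma t) (gamma (- t))).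
have du t : t \in `[- T, T] -> is_derive t 1 u (u' t).
  move=> tT; apply: (@is_deriveD _ _ _ (fun s => X s *m c) (fun s => Zmx X Y s *m w s)).
    exact (is_derive_mulmxr c (homogeneous_solution_is_derive t hX)).
  apply: is_derive_eq.
    exact (is_derive_mulmx (is_derive_row_mx (homogeneous_solution_is_derive t hX)
      (homogeneous_solution_is_derive t hY)) (dw _ tT)).
  rewrite /= -[row_mx (X t) (Y t)]/(Zmx X Y t) Zmx_calX -mulmxA mulKVmx ?calX_unit//.
  by congr (_ + _); rewrite /a scalemxAr.
have u_sol : bvp_solution T F G A B C K gamma delta u.
  have du_on t tT := is_derive_derive_on T_gt0 tT (du t tT).
  split=> [t tT|t tT|]; first exact: (du_on t tT).1.
    rewrite (du_on t tT).2 (du_on _ (memN _ tT)).2 /u /u' wN opprK.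
    rewrite -[w t]vsubmxK mul_reflect_col_mx homogeneous_combination.
    - exact: source_term.
    - exact: hX.2.
    - exact: hY.2.
  have : M *m c = delta - K *m Zmx X Y T *m w T - C *m Zmx X Y (- T) *m w (- T).
    by rewrite mulKVmx.
  rewrite /u {1}/M /MX mulmxDl !mulmxDr !mulmxA addrACA => ->.
  move: (K *m Zmx X Y T *m w T) (C *m Zmx X Y (- T) *m w (- T)) => x y.
  by rewrite -(addrA delta) -opprD (addrC y) subrK.
exists u; split => // [v|t tT].
  exact: (bvp_solution_unique T_gt0 FBG_unit FDG_unit hX hY calX_unit MX_unit u_sol).
have [iZ eZ] := integral_vec_mulmx (Zmx X Y t) mI (iW _ tT).1.
have [iK eK] := integral_vec_mulmx (- GammaK T C K X Y t) mI (iW _ TT).1.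
have [iC eC] := integral_vec_mulmx (- GammaC T C K X Y t) mI (iW _ NT).1.
have [iZK eZK] := integral_vecD mI iZ iK.
have [iS eS] := integral_vecD mI iZK iC.
(* The cases of [green] omit 0, [t] and [- t]; the endpoints are removed because [green_oind] needs
   [s] in the open interval. *)
pose N : set R := [set` [:: 0; t; - t; T; - T]].
have cN : countable N by apply: finite_set_countable; exact: finite_seq.
have [] := eq_integral_vec_off_countable
  (f := fun s => green T F G C K X Y t s *m gamma s) mI cN _ iS.
  move=> s sT Ns.
  have /and5P[s0 st sNt sT' sNT] : [&& s != 0, s != t, s != - t, s != T & s != - T].
    by apply: contrapT => sN; apply: Ns; rewrite /N/= !inE; move: sN; do 5 case: eqP.
  have sI : s \in `]- T, T[.
    have : s \in `[- T, T] by exact: sT.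
    by rewrite !in_itv/= => /andP[? ?]; rewrite !lt_neqAle sT' eq_sym sNT; apply/andP.
  rewrite green_oind//= !mulNmx /W /p clamp_id; last exact: sT.
  by rewrite invmx_calXN_Vminus ?calX_unit// mulNmx !mulmxA.
move=> ig ->; split=> //.
rewrite eS eZK eZ eK eC (iW _ tT).2 (iW _ TT).2 (iW _ NT).2.
(* Expanding [c] in [u] yields the [delta] term and the terms in [GammaK] and [GammaC]. *)
rewrite /u /c; move: (w t) (w T) (w (- T)) => wt wT wNT.
rewrite /GammaK /GammaC !mulmxBr !mulNmx !mulmxA.
rewrite -!addrA; congr (_ + _).
by rewrite [LHS]addrA addrC.
Qed.
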